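(* Let $n\ge 2$, $\alpha\in(0,1)$, and let $\mathbf X=(X_1,\dots,X_n)$ be the contaminated sequence described in the context, whose underlying clean sequence $\widetilde{\mathbf X}$ is split-exchangeable (in the sense defined in the context) at the true changepoint $\xi\in\{1,\dots,n-1\}$. For any choice of hyperparameters $\lambda>0$ and $\beta\in[0,1]$, the W-CONCH set $\mathcal C^w_\alpha(\mathbf X)$ defined in the context satisfies $$\Pr\bigl(\xi\in\mathcal C^w_\alpha(\mathbf X)\bigr)\ge 1-\alpha .$$
   Context: Data model. $\mathcal X$ is the observation space, and $\xi\in\{1,\dots,n-1\}$ is a fixed unknown index. The clean sequence $\widetilde{\mathbf X}=(\widetilde X_1,\dots,\widetilde X_n)\in\mathcal X^n$ is split-exchangeable at $\xi$, meaning that its pre-change and post-change segments are each exchangeable: $$(\widetilde X_1,\dots,\widetilde X_\xi)\overset{d}{=}(\widetilde X_{\pi_0(1)},\dots,\widetilde X_{\pi_0(\xi)}),\qquad (\widetilde X_{\xi+1},\dots,\widetilde X_n)\overset{d}{=}(\widetilde X_{\pi_1(\xi+1)},\dots,\widetilde X_{\pi_1(n)})$$ for arbitrary permutations $\pi_0$ of $\{1,\dots,\xi\}$ and $\pi_1$ of $\{\xi+1,\dots,n\}$. Contamination: $Y_1,\dots,Y_n$ are i.i.d. $\mathrm{Bernoulli}(\varepsilon)$ with $\varepsilon\in(0,1)$, $Z_1,\dots,Z_n$ are i.i.d. from a distribution $Q$ on $\mathcal X$, and $\widetilde{\mathbf X}$, $(Y_i)_i$, $(Z_i)_i$ are mutually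 independent. The observation is $X_i=(1-Y_i)\widetilde X_i+Y_iZ_i$, i.e. $X_i=\widetilde X_i$ if $Y_i=0$ and $X_i=Z_i$ if $Y_i=1$. Permutations. For $t\in\{1,\dots,n-1\}$, $\Pi_t$ denotes the set of all permutations $\pi$ of $\{1,\dots,n\}$ that map $\{1,\dots,t\}$ to itself and $\{t+1,\dots,n\}$ to itself (i.e. pairs of permutations of the two blocks), and $\pi(\mathbf x)=(x_{\pi(1)},\dots,x_{\pi(n)})$. Classifier and uncertainty signal. $\hat p(0\mid x),\hat p(1\mid x)>0$, with $\hat p(0\mid x)+\hat p(1\mid x)=1$, is a fixed (measurable) binary classifier on $\mathcal X$, and $h:\mathcal X\to\mathbb R_{\ge0}$ is a fixed measurable function; neither depends on $\mathbf X$. Put $\Delta_i=\log\frac{\hat p(0\mid X_i)}{\hat p(1\mid X_i)}$ and $M_i=h(X_i)$. Weights. For a candidate $t$, let $\kappa_0(t,\beta)=\mathrm Q_{1-\beta}(\{M_1,\dots,M_t\})$ and $\kappa_1(t,\beta)=\mathrm Q_{1-\beta}(\{M_{t+1},\dots,M_n\})$, where for a finite multiset $\mathcal S$ of reals $\mathrm Q_{1-\beta}(\mathcal S)$ is the $\lfloor(1-\beta)|\mathcal S|\rfloor$-th smallest element (the smallest element if this integer is $0$). For $j\in\{0,1\}$ let $w_j(X_i)=\sigma\bigl((\kappa_j(t,\beta)-M_i)/\lambda\bigr)$ with $\sigma(u)=1/(1+e^{-u})$. Let $w^{(t)}(X_i)=w_0(X_i)$ for $i\le t$ and $w^{(t)}(X_i)=w_1(X_i)$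 for $i>t$. Score. Let $N_t(s)=\sum_{i\le s}w^{(t)}(X_i)\log\hat p(0\mid X_i)+\sum_{i>s}w^{(t)}(X_i)\log\hat p(1\mid X_i)$, let $\hat\xi_t(\mathbf X)\in\arg\max_{s\in\{1,\dots,n-1\}}N_t(s)$ (the score $S^w_t(\mathbf X)$ does not depend on how ties are broken), and $$S^w_t(\mathbf X)=\sum_{i\le t}w_0(X_i)\Delta_i-\sum_{i\le\hat\xi_t(\mathbf X)}w^{(t)}(X_i)\Delta_i .$$ $S_t^w$ is regarded as a function of the whole sequence, so that $S_t^w(\pi(\mathbf X))$ is obtained by recomputing the quantities $\Delta_i$, $M_i$, $\kappa_0(t,\beta)$, $\kappa_1(t,\beta)$, $w_0$, $w_1$, $w^{(t)}$, $N_t$, $\hat\xi_t$ and then $S_t^w$ with $\mathbf X$ replaced by $\pi(\mathbf X)$. W-CONCH set. $p^w_t(\mathbf X)=\frac1{|\Pi_t|}\sum_{\pi\in\Pi_t}\mathbf 1\bigl[S^w_t(\pi(\mathbf X))\le S^w_t(\mathbf X)\bigr]$ and $\mathcal C^w_\alpha(\mathbf X)=\{t\in\{1,\dots,n-1\}:p^w_t(\mathbf X)>\alpha\}$.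
   Formalization: Split-exchangeability is taken jointly: the law of the whole clean sequence is invariant under every pair of permutations of the two segments. With each segment only marginally exchangeable, as displayed, the coverage claim is false. *)

(* Defs.v *)
(* The index i in {1..n} is the ordinal of value i - 1, so "i <= t" reads
   [(i < t)%N] and "i > t" reads [(t <= i)%N] on ordinals; changepoints t, s are
   natural numbers in {1..n-1}.  Classifier label 0 is [false], 1 is [true]. *)
From HB Require Import structures.
From mathcomp Require Import all_boot all_order all_algebra all_fingroup.
From mathcomp Require Import all_classical all_reals all_analysis.

Set Implicit Arguments.
Unset Strict Implicit.
Unset Printing Implicit Defensive.

Import Order.TTheory GRing.Theory Num.Theory.
Import numFieldNormedType.Exports.

Local Open Scope classical_set_scope.
Local Open Scope ring_scope.

Definition changepoint (n t : nat) : bool := (0 < t < n)%N.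

Definition block_perms (n t : nat) : {set {perm 'I_n}} :=
  [set s : {perm 'I_n} | [forall i : 'I_n, (s i < t)%N == (i < t)%N]].

Definition permute (E : Type) (n : nat) (s : {perm 'I_n}) (x : n.-tuple E) :
  n.-tuple E := [tuple tnth x (s i) | i < n].

Section probability.
Context (d : measure_display) (Om : measurableType d) (R : realType)
  (P : probability Om R).

Definition eq_in_law (d' : measure_display) (E : measurableType d')
    (U V : Om -> E) : Prop :=
  forall A : set E, measurable A -> P (U @^-1` A) = P (V @^-1` A).

(* Invariance of the joint law of the two segments: a pair of permutations
   (pi_0, pi_1) of the blocks {1..t} and {t+1..n} is one element of
   [block_perms n t].  Exchangeability of each segment's marginal law alone is
   strictly weaker, as it allows the order inside the first segment to depend
   on the order inside the second one. *)
Definition split_exchangeable (d' : measure_display) (E : measurableType d')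
    (n t : nat) (U : Om -> n.-tuple E) : Prop :=
  forall s, s \in block_perms n t -> eq_in_law (fun w => permute s (U w)) U.

Definition sigma_of (d' : measure_display) (E : measurableType d')
    (U : Om -> E) : set (set Om) :=
  preimage_set_system [set: Om] U measurable.

Definition independent_systems (I : finType) (F : I -> set (set Om)) : Prop :=
  forall (J : {set I}) (A : I -> set Om),
    (forall i, i \in J -> F i (A i)) ->
    P (\bigcap_(i in [set` J]) A i) = (\prod_(i in J) P (A i))%E.

Definition iid (d' : measure_display) (E : measurableType d') (n : nat)
    (mu : set E -> \bar R) (U : Om -> n.-tuple E) : Prop :=
  (forall (i : 'I_n) (A : set E), measurable A ->
     P ((fun w => tnth (U w) i) @^-1` A) = mu A) /\
  independent_systems (fun i : 'I_n => sigma_of (fun w => tnth (U w) i)).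

Definition independent3 (d1 d2 d3 : measure_display) (E1 : measurableType d1)
    (E2 : measurableType d2) (E3 : measurableType d3)
    (U1 : Om -> E1) (U2 : Om -> E2) (U3 : Om -> E3) : Prop :=
  independent_systems (fun k : 'I_3 =>
    tnth [tuple sigma_of U1; sigma_of U2; sigma_of U3] k).

End probability.

Definition contaminate (E : Type) (n : nat) (x : n.-tuple E)
    (y : n.-tuple bool) (z : n.-tuple E) : n.-tuple E :=
  [tuple if tnth y i then tnth z i else tnth x i | i < n].

Section wconch.
Context (R : realType) (E : Type).

Definition sigmoid (u : R) : R := (1 + expR (- u))^-1.

(* The k-th smallest element has position k - 1 in the sorted sequence, and the
   truncated predecessor sends k = 0 to the smallest element. *)
Definition order_quantile (beta : R) (s : seq R) : R :=
  nth 0 (sort <=%R s) (Num.truncn ((1 - beta) * (size s)%:R)).-1.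

Variables (n : nat) (phat : bool -> E -> R) (h : E -> R) (lam beta : R).
Implicit Types (x : n.-tuple E) (i : 'I_n) (t : nat).

Definition log_odds (e : E) : R := ln (phat false e / phat true e).

Definition kappa t x (j : bool) : R :=
  order_quantile beta (map h (if j then drop t x else take t x)).

Definition seg_weight t x (j : bool) i : R :=
  sigmoid ((kappa t x j - h (tnth x i)) / lam).

Definition weight t x i : R := seg_weight t x (t <= i)%N i.

Definition weighted_loglik t x (s : nat) : R :=
  \sum_(i < n | (i < s)%N) weight t x i * ln (phat false (tnth x i)) +
  \sum_(i < n | (s <= i)%N) weight t x i * ln (phat true (tnth x i)).

Definition is_weighted_argmax t x (s : nat) : Prop :=
  changepoint n s /\
  forall s', changepoint n s' -> weighted_loglik t x s' <= weighted_loglik t x s.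

Variable xihat : nat -> n.-tuple E -> nat.

Definition wscore t x : R :=
  \sum_(i < n | (i < t)%N) seg_weight t x false i * log_odds (tnth x i) -
  \sum_(i < n | (i < xihat t x)%N) weight t x i * log_odds (tnth x i).

Definition wpvalue t x : R :=
  (#|block_perms n t|%:R)^-1 *
  \sum_(s in block_perms n t) (wscore t (permute s x) <= wscore t x)%R%:R.

Definition wconch_set (alpha : R) x : set nat :=
  [set t | changepoint n t /\ alpha < wpvalue t x].

End wconch.

(* Main.v *)
(* The contaminated sequence inherits the block exchangeability of the clean one:
   on the event Y = y, the probability that X lies in a box is that of a box for
   the clean sequence times products over the i.i.d. Y and Z, and permuting X
   amounts to permuting y, over which one sums.
   Hence p(X) and p(s(X)) have the same law for every block permutation s.  For
   a fixed x, at most a fraction alpha of the s satisfy p(s(x)) <= alpha, because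
   p(s(x)) is the normalized rank of S(s(x)) in the orbit of x; averaging over s
   and taking expectations bounds P(p(X) <= alpha) by alpha. *)
Require Import Defs.
From HB Require Import structures.
From mathcomp Require Import all_boot all_order all_algebra all_fingroup.
From mathcomp Require Import all_classical all_reals all_analysis.
From mathcomp Require Import measurable_realfun.

Set Implicit Arguments.
Unset Strict Implicit.
Unset Printing Implicit Defensive.

Import Order.TTheory GRing.Theory Num.Theory.
Import numFieldNormedType.Exports.

Local Open Scope classical_set_scope.
Local Open Scope ring_scope.

(** * Laws of random tuples, determined by their values on boxes *)

Definition box (T : Type) (n : nat) (A : 'I_n -> set T) : set (n.-tuple T) :=
  [set x | forall i, A i (tnth x i)].

Section tuple_law.
Context (d d' : measure_display) (Om : measurableType d) (E : measurableType d')
  (R : realType) (P : probability Om R) (n : nat).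

Lemma measurable_box (A : 'I_n -> set E) :
  (forall i, measurable (A i)) -> measurable (box A).
Proof.
move=> mA; have -> : box A = \bigcap_(i in setT) ((fun x => tnth x i) @^-1` A i).
  by apply/seteqP; split=> x; [move=> Ax i _; exact: Ax|move=> Ax i; exact: Ax].
apply: fin_bigcap_measurable => // i _.
by rewrite -[X in measurable X]setTI; exact: measurable_tnth.
Qed.

(** Boxes with measurable sides are stable under intersection and generate the product
    sigma-algebra, so two probability laws that agree on them coincide. *)
Lemma eq_in_law_box (U V : Om -> n.-tuple E) :
  measurable_fun [set: Om] U -> measurable_fun [set: Om] V ->
  (forall A : 'I_n -> set E, (forall i, measurable (A i)) ->
     P (U @^-1` box A) = P (V @^-1` box A)) ->
  eq_in_law P U V.
Proof.
move=> mU mV UV B mB.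
pose U' : {mfun Om >-> n.-tuple E} := mfun_Sub (mem_set mU).
pose V' : {mfun Om >-> n.-tuple E} := mfun_Sub (mem_set mV).
pose G := [set box A | A in [set A : 'I_n -> set E | forall i, measurable (A i)]].
have GT : G setT by exists (fun=> setT) => //; apply/seteqP; split.
suff sB : <<s G >> B.
  apply: (@g_sigma_algebra_measure_unique _ R _ G _ (fun=> setT) _ _
    (distribution P U') (distribution P V')) => //.
  - by move=> _ [A mA <-]; exact: measurable_box.
  - by rewrite bigcup_const.
  - move=> _ _ [A mA <-] [A' mA' <-]; exists (fun i => A i `&` A' i).
      by move=> i; exact: measurableI.
    apply/seteqP; split=> x; first by move=> Ax; split=> i; case: (Ax i).
    by move=> [Ax A'x] i; split.
  - by move=> _ [A mA <-]; exact: UV.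
  - by move=> _; rewrite (le_lt_trans (probability_le1 _ _)) ?ltry.
(* The product sigma-algebra is generated by the preimages of measurable sets under single
   coordinates; each is a box with all sides but one equal to [setT]. *)
apply: sub_sigma_algebra2 mB => C; rewrite -bigcup_seq => -[i _ [D mD <-]].
exists (fun j => if j == i then D else setT).
  by move=> j; case: ifP.
apply/seteqP; split=> x.
  by move=> /(_ i); rewrite eqxx.
by move=> [_ Dx] j; case: eqP => // ->.
Qed.

Lemma permute_tnth (T : Type) (s : {perm 'I_n}) (x : n.-tuple T) i :
  tnth (permute s x) i = tnth x (s i).
Proof. by rewrite tnth_mktuple. Qed.

Lemma measurable_permute (s : {perm 'I_n}) :
  measurable_fun [set: n.-tuple E] (permute s).
Proof.
apply/measurable_fun_tnthP => i; rewrite /comp /=.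
under eq_fun do rewrite permute_tnth.
exact: measurable_tnth.
Qed.

End tuple_law.

(** * Block permutations as a group, ranks in a finite set, and the action on boxes *)

Lemma permuteM (T : Type) n (s s' : {perm 'I_n}) (x : n.-tuple T) :
  permute s' (permute s x) = permute (s' * s)%g x.
Proof. by apply: eq_from_tnth => i; rewrite !permute_tnth permM. Qed.

Lemma block_permsM n t (s s' : {perm 'I_n}) :
  s \in block_perms n t -> s' \in block_perms n t ->
  (s * s')%g \in block_perms n t.
Proof.
rewrite !inE => /forallP st /forallP s't; apply/forallP => i.
by rewrite permM (eqP (s't _)) (eqP (st _)).
Qed.

Lemma block_permsV n t (s : {perm 'I_n}) :
  (s^-1%g \in block_perms n t) = (s \in block_perms n t).
Proof.
suff H (u : {perm 'I_n}) : u \in block_perms n t -> u^-1%g \in block_perms n t.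
  by apply/idP/idP => /H //; rewrite invgK.
rewrite !inE => /forallP ut; apply/forallP => i.
by rewrite -(eqP (ut _)) permKV.
Qed.

Lemma block_perms1 n t : 1%g \in block_perms n t.
Proof. by rewrite inE; apply/forallP => i; rewrite perm1. Qed.

(** The worst case is an element [s] of low rank with the largest [f s]: every other low-rank
    element lies below it, hence is among the at most [k] elements counted by the rank of [s]. Ties
    only increase ranks, so they do no harm. *)
Lemma card_low_rank (R : realType) (I : finType) (G : {set I}) (f : I -> R)
    (k : nat) :
  (#|[set s in G | (#|[set s' in G | (f s' <= f s)%R]| <= k)%N]| <= k)%N.
Proof.
set B := [set s in G | _]; have [->|[s0 s0B]] := set_0Vmem B; first by rewrite cards0.
have [s sB smax] := @arg_maxP _ _ _ s0 [in B] f s0B.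
have := sB; rewrite inE => /andP[_]; apply: leq_trans.
apply: subset_leq_card; apply/fintype.subsetP => s' s'B.
have fs' : f s' <= f s := smax _ s'B.
by rewrite inE fs' andbT; move: s'B; rewrite inE => /andP[].
Qed.

Lemma preimage_permute_box (T : Type) n (s : {perm 'I_n}) (A : 'I_n -> set T) :
  permute s @^-1` box A = box (fun i => A (s^-1%g i)).
Proof.
apply/seteqP; split=> x Ax i.
  by have := Ax (s^-1%g i); rewrite permute_tnth permKV.
by have := Ax (s i); rewrite permute_tnth permK.
Qed.

Lemma permute_bij (T : Type) n (s : {perm 'I_n}) :
  bijective (permute s : n.-tuple T -> n.-tuple T).
Proof.
by exists (permute s^-1%g) => x; apply: eq_from_tnth => i;
  rewrite !permute_tnth ?permKV ?permK.
Qed.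

(** * Contamination preserves block exchangeability *)

Section contamination.
Context (d d' : measure_display) (Om : measurableType d) (E : measurableType d')
  (R : realType) (P : probability Om R) (n : nat).
Local Open Scope ereal_scope.

Lemma iid_box (d2 : measure_display) (T : measurableType d2)
    (mu : set T -> \bar R) (U : Om -> n.-tuple T) (A : 'I_n -> set T) :
  iid P mu U -> (forall i, measurable (A i)) ->
  P (U @^-1` box A) = \prod_(i < n) mu (A i).
Proof.
move=> [Umu /(_ [set: 'I_n]%SET (fun i => (fun w => tnth (U w) i) @^-1` A i)) Uind] mA.
have -> : U @^-1` box A =
    \bigcap_(i in [set` [set: 'I_n]%SET]) ((fun w => tnth (U w) i) @^-1` A i).
  apply/seteqP; split=> w Aw i; first by move=> _; exact: Aw.
  by apply: Aw; rewrite /= inE.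
rewrite Uind; last by move=> i _; exists (A i) => //; rewrite setTI.
by apply: eq_big => [i|i _]; [rewrite inE|exact: Umu].
Qed.

Lemma independent3_preimage (d1 d2 d3 : measure_display) (E1 : measurableType d1)
    (E2 : measurableType d2) (E3 : measurableType d3)
    (U1 : Om -> E1) (U2 : Om -> E2) (U3 : Om -> E3) A1 A2 A3 :
  independent3 P U1 U2 U3 -> measurable A1 -> measurable A2 -> measurable A3 ->
  P (U1 @^-1` A1 `&` (U2 @^-1` A2 `&` U3 @^-1` A3)) =
  P (U1 @^-1` A1) * (P (U2 @^-1` A2) * P (U3 @^-1` A3)).
Proof.
pose F := [tuple U1 @^-1` A1; U2 @^-1` A2; U3 @^-1` A3].
move=> /(_ [set: 'I_3]%SET (tnth F)) U123 m1 m2 m3.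
have -> : U1 @^-1` A1 `&` (U2 @^-1` A2 `&` U3 @^-1` A3) =
    \bigcap_(k in [set` [set: 'I_3]%SET]) tnth F k.
  apply/seteqP; split=> w.
    by move=> [w1 [w2 w3]] [[|[|[|]]] //= ?] _.
  move=> Fw; split; first by apply: (Fw (@Ordinal 3 0 isT)); rewrite /= inE.
  split; first by apply: (Fw (@Ordinal 3 1 isT)); rewrite /= inE.
  by apply: (Fw (@Ordinal 3 2 isT)); rewrite /= inE.
rewrite U123; last first.
  move=> [[|[|[|]]] //= ?] _; rewrite /tnth /=;
  by [exists A1; rewrite ?setTI|exists A2; rewrite ?setTI|exists A3; rewrite ?setTI].
rewrite (eq_bigl xpredT) => [|k]; last by rewrite inE.
by rewrite !big_ord_recl big_ord0 mule1.
Qed.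

Variables (muY : set bool -> \bar R) (Q : set E -> \bar R) (t : nat).
Variables (X Z : Om -> n.-tuple E) (Y : Om -> n.-tuple bool).
Hypotheses (mX : measurable_fun [set: Om] X) (mY : measurable_fun [set: Om] Y)
  (mZ : measurable_fun [set: Om] Z).
Hypotheses (iidY : iid P muY Y) (iidZ : iid P Q Z).
Hypothesis XYZ : independent3 P X Y Z.

Let W w := contaminate (X w) (Y w) (Z w).

Lemma measurable_contaminate : measurable_fun [set: Om] W.
Proof.
apply/measurable_fun_tnthP => i; rewrite /comp /=.
under eq_fun do rewrite tnth_mktuple.
have mt (d2 : measure_display) (T : measurableType d2) (U : Om -> n.-tuple T) :
    measurable_fun setT U -> measurable_fun setT (fun w => tnth (U w) i).
  by move=> mU; exact: (measurableT_comp (measurable_tnth i) mU).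
by apply: measurable_fun_ifT; exact: mt.
Qed.

(** Once [Y = y] is fixed, the side [A i] constrains either [Z] or [X] at coordinate [i], according
    to [tnth y i]. The event is then an intersection of one box event for each of [X], [Y], [Z], and
    independence factors it. *)
Lemma contaminate_box (A : 'I_n -> set E) : (forall i, measurable (A i)) ->
  P (W @^-1` box A) =
  \sum_(y : n.-tuple bool)
    P (X @^-1` box (fun i => if tnth y i then setT else A i)) *
    ((\prod_(i < n) muY [set tnth y i]) *
     (\prod_(i < n) Q (if tnth y i then A i else setT))).
Proof.
move=> mA.
(* The events [F y] partition the box event into finitely many measurable pieces, one for each
   contamination pattern. *)
pose F (y : n.-tuple bool) := W @^-1` box A `&` Y @^-1` [set y].
have FE y : F y = X @^-1` box (fun i => if tnth y i then setT else A i) `&`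
    (Y @^-1` box (fun i => [set tnth y i]) `&`
     Z @^-1` box (fun i => if tnth y i then A i else setT)).
  apply/seteqP; split=> w.
    move=> [Aw /= Yw]; split; [|split] => i; have := Aw i;
    by rewrite tnth_mktuple Yw //=; case: (tnth y i).
  move=> [/= Xw [Yw Zw]].
  have YE : Y w = y by apply: eq_from_tnth => i; exact: Yw.
  split => //= i; have := Xw i; have := Zw i.
  by rewrite tnth_mktuple YE; case: (tnth y i).
have mFX y : measurable (box (fun i => if tnth y i then setT else A i)).
  by apply: measurable_box => i; case: ifP.
have mFY (y : n.-tuple bool) : measurable (box (fun i => [set tnth y i])).
  by apply: measurable_box.
have mFZ y : measurable (box (fun i => if tnth y i then A i else setT)).
  by apply: measurable_box => i; case: ifP.
have mF y : measurable (F y).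
  rewrite FE; apply: measurableI; first by rewrite -[X in measurable X]setTI; exact: mX.
  by apply: measurableI; rewrite -[X in measurable X]setTI; [exact: mY|exact: mZ].
have -> : W @^-1` box A = \bigcup_(y in setT) F y.
  by apply/seteqP; split=> w; [move=> Aw; exists (Y w)|move=> [y _ []]].
rewrite measure_fin_bigcup//; first last.
- by move=> y y' _ _ [w [[_ <-] [_ <-]]].
- exact: finite_finset.
rewrite (fsbigE (index_enum _)) ?index_enum_uniq//; last first.
  by move=> y /=; rewrite mem_index_enum.
apply: eq_big => [y|y _]; first by rewrite in_setT.
rewrite /= FE (independent3_preimage XYZ)// (iid_box iidY)// (iid_box iidZ)//.
by move=> i; case: ifP.
Qed.

Lemma contaminate_exchangeable :
  split_exchangeable P t X -> split_exchangeable P t W.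
Proof.
move=> exX s st.
have mW := measurable_contaminate.
apply: eq_in_law_box => // [|A mA].
  exact: (measurableT_comp (measurable_permute _) mW).
have -> : (fun w => permute s (W w)) @^-1` box A =
    W @^-1` box (fun i => A (s^-1%g i)) by rewrite -preimage_permute_box.
(* Shifting the pattern [y] by the same [s^-1] as the sides of the box keeps each side paired with
   its own contamination flag. *)
rewrite !contaminate_box// (reindex (permute s^-1%g)) /=; last first.
  exact: onW_bij (permute_bij _ _).
apply: eq_bigr => y _; congr (_ * (_ * _)).
(* The factor for [X] is the only one that uses [s] being a block permutation; the factors for [Y]
   and [Z] are products of identical marginals, which any reordering of the indices preserves. *)
- pose B i : set E := if tnth y i then setT else A i.
  have mB : measurable (box B) by apply: measurable_box => i; rewrite /B; case: ifP.
  transitivity (P (X @^-1` (permute s @^-1` box B))); last exact: exX.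
  rewrite preimage_permute_box; congr (P (_ @^-1` box _)).
  by apply/funext => i; rewrite permute_tnth.
- rewrite (reindex_inj (@perm_inj _ s)); apply: eq_bigr => i _.
  by rewrite permute_tnth permK.
- rewrite (reindex_inj (@perm_inj _ s)); apply: eq_bigr => i _.
  by rewrite permute_tnth !permK.
Qed.

End contamination.

(** * Validity of the permutation p-value for an arbitrary measurable statistic *)

Lemma measurable_fun_natr_bool (d : measure_display) (T : measurableType d)
    (R : realType) (f : T -> bool) :
  measurable_fun [set: T] f -> measurable_fun [set: T] (fun x => (f x)%:R : R).
Proof.
move=> mf; rewrite (_ : (fun x => _) = (fun x => if f x then 1 else 0)).
  exact: measurable_fun_ifT.
by apply/funext => x; case: (f x).
Qed.

Section permutation_test.
Context (d d' : measure_display) (Om : measurableType d) (E : measurableType d')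
  (R : realType) (P : probability Om R) (n t : nat).
Variables (S : n.-tuple E -> R).

(** This is [wpvalue] with the score abstracted to [S]: the validity argument uses nothing about the
    score beyond its measurability. *)
Definition perm_pvalue (x : n.-tuple E) : R :=
  (#|block_perms n t|%:R)^-1 *
  \sum_(s in block_perms n t) (S (permute s x) <= S x)%R%:R.

Lemma card_block_perms_gt0 : (0 < #|block_perms n t|)%N.
Proof. by apply/card_gt0P; exists 1%g; exact: block_perms1. Qed.

(** Block permutations form a group, so [x] and [permute s x] have the same orbit; the p-value at
    [permute s x] is a normalized rank within the orbit of [x]. *)
Lemma perm_pvalue_permute (s : {perm 'I_n}) (x : n.-tuple E) :
  s \in block_perms n t ->
  perm_pvalue (permute s x) = (#|block_perms n t|%:R)^-1 *
    #|[set s' in block_perms n t | (S (permute s' x) <= S (permute s x))%R]|%:R.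
Proof.
move=> st; congr (_ * _); rewrite -sum1_card natr_sum.
rewrite (reindex_inj (mulIg s^-1)%g) /= big_mkcond [RHS]big_mkcond /=.
apply: eq_bigr => s' _; rewrite permuteM mulgKV.
have -> : (s' * s^-1 \in block_perms n t)%g = (s' \in block_perms n t).
  apply/idP/idP => s't; last by rewrite block_permsM ?block_permsV.
  by rewrite -(mulgKV s s') block_permsM.
rewrite [X in _ = if X then _ else _]finset.in_set.
by case: (s' \in _) => //=; case: (_ <= _)%R.
Qed.

Lemma sum_perm_pvalue_le (alpha : R) (x : n.-tuple E) : 0 <= alpha ->
  \sum_(s in block_perms n t) (perm_pvalue (permute s x) <= alpha)%R%:R
    <= alpha * #|block_perms n t|%:R.
Proof.
move=> a0; set G := block_perms n t; set k := Num.truncn (alpha * #|G|%:R).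
have aG0 : 0 <= alpha * #|G|%:R by rewrite mulr_ge0.
(* A rank is an integer, so rank over [#|G|] is at most [alpha] exactly when the rank is at most
   [k], the integer part of [alpha * #|G|]; [card_low_rank] then applies with this [k]. *)
rewrite (eq_bigr (fun s => if (#|[set s' in G | (S (permute s' x) <=
    S (permute s x))%R]| <= k)%N then 1 else 0)); last first.
  move=> s sG; rewrite perm_pvalue_permute// mulrC ler_pdivrMr ?ltr0n ?card_block_perms_gt0//.
  by rewrite -truncn_ge_nat//; case: (_ <= _)%N.
rewrite -big_mkcondr /= sumr_const (@le_trans _ _ k%:R) ?truncn_le// ler_nat.
rewrite (leq_trans _ (card_low_rank G (fun s => S (permute s x)) k))//.
by apply/eq_leq/eq_card => s; rewrite [RHS]finset.in_set.
Qed.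

Hypothesis mS : measurable_fun [set: n.-tuple E] S.

Lemma measurable_perm_pvalue : measurable_fun [set: n.-tuple E] perm_pvalue.
Proof.
apply: measurable_funM => //.
under eq_fun do rewrite big_mkcond /=.
apply: measurable_sum => s; case: (s \in _) => //.
apply: measurable_fun_natr_bool; apply: measurable_fun_ler => //.
exact: (measurableT_comp mS (measurable_permute _)).
Qed.

Local Open Scope ereal_scope.

Lemma perm_test_valid (X : Om -> n.-tuple E) (alpha : R) : (0 <= alpha)%R ->
  measurable_fun [set: Om] X -> split_exchangeable P t X ->
  (1 - alpha)%:E <= P [set w | (alpha < perm_pvalue (X w))%R].
Proof.
move=> a0 mX exX; set G := block_perms n t.
pose B := [set x | (perm_pvalue x <= alpha)%R].
have mB : measurable B.
  rewrite [B](_ : _ = setT `&` perm_pvalue @^-1` `]-oo, alpha]); last first.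
    by rewrite setTI set_itvNyc.
  exact: measurable_perm_pvalue.
have mXB : measurable (X @^-1` B) by rewrite -[X in measurable X]setTI; exact: mX.
have mBs s : measurable ((fun w => permute s (X w)) @^-1` B).
  rewrite -[X in measurable X]setTI.
  exact: (measurableT_comp (measurable_permute s) mX).
have mterm s : measurable_fun [set: Om]
    (fun w => (perm_pvalue (permute s (X w)) <= alpha)%R%:R : R).
  apply: measurable_fun_natr_bool; apply: measurable_fun_ler => //.
  apply: (measurableT_comp measurable_perm_pvalue).
  exact: (measurableT_comp (measurable_permute s) mX).
(* Exchangeability turns [#|G|] copies of the rejection probability into a sum over [G], which is
   the expectation of the number of rejecting permutations; that number is at most [alpha * #|G|] at
   every outcome. *)
have PB : P (X @^-1` B) * #|G|%:R%:E <= (alpha * #|G|%:R)%:E.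
  have -> : P (X @^-1` B) * #|G|%:R%:E =
      \sum_(s in G) P ((fun w => permute s (X w)) @^-1` B).
    rewrite (eq_bigr (fun=> P (X @^-1` B))); last by move=> s sG; rewrite exX.
    by rewrite -[P _]fineK ?fin_num_measure// sumEFin sumr_const -EFinM mulr_natr.
  rewrite -big_filter.
  have PE s : P ((fun w => permute s (X w)) @^-1` B) =
      \int[P]_w ((perm_pvalue (permute s (X w)) <= alpha)%R%:R)%:E.
    transitivity (\int[P]_w (\1_((fun w => permute s (X w)) @^-1` B) w)%:E).
      by rewrite integral_indic// setIT.
    by apply: eq_integral => w _; rewrite indicE mem_setE.
  rewrite (eq_bigr _ (fun s _ => PE s)) -ge0_integral_sum//; last first.
    move=> s; apply/measurable_EFinP.
    exact: mterm.
  rewrite (@le_trans _ _ (\int[P]_w (alpha * #|G|%:R)%:E))//.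
    apply: ge0_le_integral => //.
    - by move=> w _; apply: sume_ge0 => s _; rewrite lee_fin.
    - apply: emeasurable_sum => s; apply/measurable_EFinP.
      exact: mterm.
    - by move=> w _; rewrite big_filter sumEFin lee_fin sum_perm_pvalue_le.
  by rewrite integral_cst// [X in _ * X]probability_setT mule1.
have -> : [set w | (alpha < perm_pvalue (X w))%R] = ~` (X @^-1` B).
  by apply/seteqP; split=> w /=; rewrite real_ltNge ?num_real//; move/negP.
rewrite probability_setC// EFinB .
(* The positive factor [#|G|] cancels, leaving a rejection probability of at most [alpha]. *)
by move: PB; rewrite EFinM lee_pmul2r ?lte_fin ?ltr0n ?card_block_perms_gt0//; exact: leeB.
Qed.

End permutation_test.

(** * Measurability of order statistics, of the weights and of the score *)

Lemma measurable_order_statistic (d : measure_display) (T : measurableType d)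
    (R : realType) (I : Type) (r : seq I) (f : I -> T -> R) (k : nat) :
  (forall i, measurable_fun [set: T] (f i)) ->
  measurable_fun [set: T] (fun x => nth 0 (sort <=%R [seq f i x | i <- r]) k).
Proof.
move=> mf; have [rk|kr] := leqP (size r) k.
  rewrite (_ : (fun x => _) = cst 0) //; apply/funext => x.
  by rewrite nth_default// size_sort size_map.
apply: (measurability _ (RGenOInfty.measurableE R)) => //.
move=> _ [_ [a ->] <-].
pose N x : R := \sum_(i <- r) (f i x <= a)%R%:R.
have NE x : N x = (count (<= a) (sort <=%R [seq f i x | i <- r]))%:R.
  by rewrite count_sort count_map -sum1_count natr_sum [RHS]big_mkcond;
    apply: eq_bigr => i _ /=; case: ifP.
have mN : measurable_fun [set: T] N.
  apply: measurable_sum => i; apply: measurable_fun_natr_bool.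
  exact: measurable_fun_ler.
(* Positions start at 0: the entry at position [k] of the sorted list exceeds [a] exactly when at
   most [k] entries are [<= a]. The count [N] is a finite sum of indicators, so no measurability of
   sorting itself is involved. *)
rewrite [X in measurable X](_ : _ = setT `&` N @^-1` `]-oo, k%:R]).
  exact: mN.
apply/seteqP; split=> x [_]; rewrite /= !in_itv /= ?andbT => xa; split => //.
  rewrite NE ler_nat leqNgt; apply/negP => kN.
  by have := nth_count_le 0 (sort_le_sorted _) kN; rewrite leNgt xa.
apply: nth_count_gt; first exact: sort_le_sorted.
by rewrite -(ler_nat R) -NE xa size_sort size_map.
Qed.

Section wscore.
Context (R : realType) (d : measure_display) (E : measurableType d) (n : nat).
Variables (phat : bool -> E -> R) (h : E -> R) (lam beta : R).
Hypothesis phat_meas : forall b, measurable_fun [set: E] (phat b).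
Hypothesis phat_gt0 : forall b x, 0 < phat b x.
Hypothesis h_meas : measurable_fun [set: E] h.

Let measurable_tnth_comp (g : E -> R) (i : 'I_n) :
  measurable_fun [set: E] g ->
  measurable_fun [set: n.-tuple E] (fun x => g (tnth x i)).
Proof. by move=> mg; exact: (measurableT_comp mg (measurable_tnth i)). Qed.

Lemma log_oddsE e : log_odds phat e = ln (phat false e) - ln (phat true e).
Proof. by rewrite /log_odds ln_div// posrE. Qed.

Lemma measurable_log_odds : measurable_fun [set: E] (log_odds phat).
Proof.
rewrite (_ : log_odds phat = fun e => ln (phat false e) - ln (phat true e)).
  by apply: measurable_funB; apply: measurableT_comp.
by apply/funext => e; exact: log_oddsE.
Qed.

Lemma measurable_sigmoid : measurable_fun [set: R] (@sigmoid R).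
Proof.
(* The inverse is written as an exponential of minus a logarithm, making the sigmoid a composition
   of measurable functions. *)
rewrite (_ : @sigmoid R = fun u => expR (- ln (1 + expR (- u)))).
  apply: measurableT_comp => //; apply: measurableT_comp => //.
  apply: measurableT_comp => //; apply: measurable_funD => //.
  exact: measurableT_comp.
apply/funext => u; rewrite expRN lnK// posrE.
by rewrite addr_gt0// expR_gt0.
Qed.

Lemma measurable_kappa t j :
  measurable_fun [set: n.-tuple E] (fun x => kappa h beta t x j).
Proof.
(* The segment is described by a list of indices that does not depend on [x]; its length, and hence
   the rank selected by the quantile, is then a constant. *)
pose r := if j then drop t (enum 'I_n) else take t (enum 'I_n).
have rE (x : n.-tuple E) : (if j then drop t x else take t x) = [seq tnth x i | i <- r].
  by rewrite /r -{1 2}(map_tnth_enum x); case: (j); rewrite ?map_drop ?map_take.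
rewrite /kappa /order_quantile.
under eq_fun do rewrite rE !size_map -map_comp.
by apply: measurable_order_statistic => i; exact: measurable_tnth_comp.
Qed.

Lemma measurable_seg_weight t j (i : 'I_n) :
  measurable_fun [set: n.-tuple E] (fun x => seg_weight h lam beta t x j i).
Proof.
apply: (measurableT_comp measurable_sigmoid).
apply: measurable_funM => //; apply: measurable_funB; first exact: measurable_kappa.
exact: measurable_tnth_comp.
Qed.

(** The second sum of [wscore] with its endpoint [s] left free. *)
Definition cusum t (s : nat) (x : n.-tuple E) : R :=
  \sum_(i < n | (i < s)%N) weight h lam beta t x i * log_odds phat (tnth x i).

Lemma measurable_cusum t s : measurable_fun [set: n.-tuple E] (cusum t s).
Proof.
rewrite /cusum; under eq_fun do rewrite big_mkcond /=.
apply: measurable_sum => i; case: (i < s)%N => //.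
apply: measurable_funM; first exact: measurable_seg_weight.
exact: (measurable_tnth_comp i measurable_log_odds).
Qed.

(** Below [s], the log of [phat false] is the log-odds plus the log of [phat true]. The remaining
    sum does not depend on [s], so maximizing the likelihood over [s] is maximizing [cusum]. *)
Lemma weighted_loglikE t s (x : n.-tuple E) :
  weighted_loglik phat h lam beta t x s =
  cusum t s x + \sum_(i < n) weight h lam beta t x i * ln (phat true (tnth x i)).
Proof.
rewrite [in RHS](bigID (fun i : 'I_n => (i < s)%N)) /= addrA -big_split /=.
congr (_ + _); last by apply: eq_bigl => i; rewrite -leqNgt.
by apply: eq_bigr => i _; rewrite log_oddsE -mulrDr subrK.
Qed.

Variable xihat : nat -> n.-tuple E -> nat.
Variable t : nat.
Hypothesis xihat_argmax : forall x,
  is_weighted_argmax phat h lam beta t x (xihat t x).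

(* The maximal value of the cumulative sum is measurable even though the
   maximizer [xihat] need not be. *)
Lemma cusum_argmaxE x : cusum t (xihat t x) x =
  \big[Num.max/cusum t 1 x]_(s < n | changepoint n s) cusum t s x.
Proof.
have [cx xmax] := xihat_argmax x.
have le_xi s : changepoint n s -> cusum t s x <= cusum t (xihat t x) x.
  by move=> cs; have := xmax s cs; rewrite !weighted_loglikE lerD2r.
have /andP[x0 xn] := cx.
apply/le_anti/andP; split.
  exact: (@le_bigmax_cond _ _ _ _ (Ordinal xn) (fun s : 'I_n => changepoint n s)
    (fun s : 'I_n => cusum t s x)).
(* The seed [cusum t 1 x] of the maximum is itself a candidate value: [1] is a changepoint because
   [0 < xihat t x < n]. *)
by apply: bigmax_le => [|s]; apply: le_xi; rewrite /changepoint (leq_ltn_trans x0).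
Qed.

Lemma measurable_wscore :
  measurable_fun [set: n.-tuple E] (wscore phat h lam beta xihat t).
Proof.
apply: measurable_funB.
  under eq_fun do rewrite big_mkcond /=.
  apply: measurable_sum => i; case: (i < t)%N => //.
  apply: measurable_funM; first exact: measurable_seg_weight.
  exact: (measurable_tnth_comp i measurable_log_odds).
(* The value at the maximizer becomes a maximum of finitely many measurable functions, treated by
   induction on the list of candidates. *)
under eq_fun do rewrite -/(cusum t _ _) cusum_argmaxE.
elim: (index_enum _) => [|s r IH].
  by under eq_fun do rewrite big_nil; exact: measurable_cusum.
under eq_fun do rewrite big_cons.
by case: (changepoint n s) => //; apply: measurable_maxr => //; exact: measurable_cusum.
Qed.

End wscore.

Theorem proposition2 (R : realType)
  (d : measure_display) (Om : measurableType d) (P : probability Om R)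
  (dX : measure_display) (E : measurableType dX)
  (n : nat) (hn : (2 <= n)%N)
  (alpha : R) (halpha : 0 < alpha < 1)
  (xi : nat) (hxi : changepoint n xi)
  (Xt : {RV P >-> n.-tuple E}) (hXt : split_exchangeable P xi Xt)
  (eps : R) (heps : 0 < eps < 1)
  (Y : {RV P >-> n.-tuple bool}) (hY : iid P (bernoulli_prob eps) Y)
  (Q : probability E R)
  (Z : {RV P >-> n.-tuple E}) (hZ : iid P Q Z)
  (hindep : independent3 P Xt Y Z)
  (phat : bool -> E -> R)
  (hphat_meas : forall b, measurable_fun [set: E] (phat b))
  (hphat_pos : forall b x, 0 < phat b x)
  (hphat_sum : forall x, phat false x + phat true x = 1)
  (h : E -> R) (hh_meas : measurable_fun [set: E] h)
  (hh_ge0 : forall x, 0 <= h x)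
  (lam : R) (hlam : 0 < lam)
  (beta : R) (hbeta : 0 <= beta <= 1)
  (xihat : nat -> n.-tuple E -> nat)
  (hxihat : forall t x, changepoint n t ->
    is_weighted_argmax phat h lam beta t x (xihat t x)) :
  ((1 - alpha)%:E <=
    P [set w | wconch_set phat h lam beta xihat alpha
                 (contaminate (Xt w) (Y w) (Z w)) xi])%E.
Proof.
have mW := measurable_contaminate (@measurable_funPT _ _ _ _ Xt)
  (@measurable_funPT _ _ _ _ Y) (@measurable_funPT _ _ _ _ Z).
have exW := contaminate_exchangeable (@measurable_funPT _ _ _ _ Xt)
  (@measurable_funPT _ _ _ _ Y) (@measurable_funPT _ _ _ _ Z) hY hZ hindep hXt.
have mS := measurable_wscore hphat_meas hphat_pos hh_meas
  (fun x => hxihat xi x hxi).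
have /andP[alpha0 _] := halpha.
(* Membership of [xi] in the set reduces to the p-value inequality, since [hxi] supplies the
   changepoint condition and [wpvalue] unfolds to [perm_pvalue] of the score. *)
rewrite (_ : [set w | _] = [set w | alpha <
  perm_pvalue xi (wscore phat h lam beta xihat xi)
    (contaminate (Xt w) (Y w) (Z w))]); first exact: perm_test_valid (ltW alpha0) mW exW.
by apply/seteqP; split=> w /=; [case|].
Qed.
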